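(* Let $Q$ be a $*$-left Ehresmann monoid with proper basis $H$ and semilattice of projections $E$, and let $T=Q/\sigma$. Then there exist a semilattice $\mathcal{X}$ with identity, an order-preserving left action of $T$ on $\mathcal{X}$, and a subsemilattice $\mathcal{Y}\cong E$ of $\mathcal{X}$ with identity satisfying conditions (A) and (B), such that $Q$ is isomorphic, as a biunary monoid, to $\mathcal{Q}_\ell(T,\mathcal{X},\mathcal{Y})$, a biunary monoid subsemigroup of $\mathcal{P}_\ell(T,\mathcal{X})$.
   Context: A semilattice is a commutative semigroup of idempotents, ordered by $e\le f$ iff $ef=e$. A $*$-left Ehresmann monoid is a monoid $M$ with unary operations $+,*$ satisfying $x^+x=x$, $(x^+y^+)^+=x^+y^+$, $x^+y^+=y^+x^+$, $(xy)^+=(xy^+)^+$, $xx^*=x$, $(x^* )^*=x^*$, $x^*y^*=y^*x^*$, $(xy^* )^*y^*=(xy^* )^*$, $(x^* )^+=x^*$, $(x^+)^*=x^+$; $E=\{a^+\}=\{a^*\}$; $\sigma$ is the least monoid congruence containing $E\times E$. $H\subseteq M$ is atomic if: (H1) $E\subseteq H$; (H2) $h\in H,e\in E$ imply $he\in H$ and $(he)^*=h^*e$; (H3) if $h\in H$, $k\in H\setminus E$, $h^*\ge k^+$ then $hk\in H$ and $(hk)^*=k^*$; (H4) every $m$ is $\sigma$-related to some $h\in H$; (H5) if $h,k,w\in H$, $hk\,\sigma\,w$, $k^*=w^*$, then some $u\in H$ has $u\,\sigma\,h$, $u^*\ge k^+$. $H$ is proper if ($h^*=k^*$ and $h\,\sigma\,k$)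 iff $h=k$. $h_1\cdots h_n$ is in $H$-canonical form if $h_i^*<h_{i+1}^+$ ($1\le i<n$) and $h_i\notin E$ ($2\le i\le n$); $M$ has $H$-canonical forms if each element has exactly one such expression. A proper basis is a proper atomic generating set $H$ (as a semigroup) for which $M$ has $H$-canonical forms. $\mathcal{P}_\ell(T,X)$ for a monoid $T$ acting on the left of a semilattice $X$ with identity by order-preserving maps: let $T*X$ be the semigroup free product acting on $X$ (elements of $X$ act by multiplication), $\omega^+=\omega\cdot1_X$, $\sim$ the semigroup congruence generated by $\{(\alpha^+\alpha,\alpha)\}\cup\{(1_T,1_X)\}$, and $\mathcal{P}_\ell(T,X)=(T*X)/\sim$ with $[\alpha]^+=[\alpha^+]$; $X$ and $T$ are identified with their injective images. It is left Ehresmann with projections $X$ and unique $T$-normal forms $t_0e_1t_1\cdots e_nt_n$ ($n\ge0$, $e_i\in X\setminus\{1\}$, $t_1,\dots,t_{n-1}\in T\setminus\{1\}$, $e_i<(t_ie_{i+1}\cdots e_nt_n)^+$); $*$ is $a^*=e_n$ if $n\ge1$, $t_n=1$, else $a^*=1$. Conditions on a subsemilattice $Y$ of $X$ with identity: (A) for $t\in T$, $e,f\in Y$, $e\le f$, $t\cdot f\in Y$ implies $t\cdot e\in Y$; (B) for each $t\in T$ some $g\in Y$ has $t\cdot g\in Y$. $\mathcal{Q}_\ell(T,X,Y)$ is the subsemigroup of $\mathcal{P}_\ell(T,X)$ generated by $\{te:t\in T,e\in Y,t\cdot e\in Y\}$, with inherited $+,*$. A biunary monoid subsemigroup is a subsemigroup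 closed under $+$ and $*$ that is a monoid (possibly with a different identity). *)

(* Defs.v *)
From Stdlib Require Import List.
Import ListNotations.


(* ---------- Monoids ---------- *)
Record Monoid := {
  mcar :> Type;
  mmul : mcar -> mcar -> mcar;
  mone : mcar;
  m_assoc : forall a b c, mmul a (mmul b c) = mmul (mmul a b) c;
  m_lid : forall a, mmul mone a = a;
  m_rid : forall a, mmul a mone = a }.

Definition monoid_hom (M N : Monoid) (f : M -> N) : Prop :=
  (forall a b, f (mmul M a b) = mmul N (f a) (f b)) /\ f (mone M) = mone N.

(* ---------- Semilattices with identity ---------- *)
Record Semilattice1 := {
  scar :> Type;
  smul : scar -> scar -> scar;
  sone : scar;
  s_assoc : forall a b c, smul a (smul b c) = smul (smul a b) c;
  s_comm : forall a b, smul a b = smul b a;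
  s_idem : forall a, smul a a = a;
  s_lid : forall a, smul sone a = a }.

Definition sle (X : Semilattice1) (e f : X) : Prop := smul X e f = e.
Definition slt (X : Semilattice1) (e f : X) : Prop := sle X e f /\ e <> f.

(* left action of a monoid T on X by order-preserving maps *)
Definition ol_action (T : Monoid) (X : Semilattice1) (act : T -> X -> X) : Prop :=
  (forall x, act (mone T) x = x) /\
  (forall s t x, act (mmul T s t) x = act s (act t x)) /\
  (forall t x y, sle X x y -> sle X (act t x) (act t y)).

(* Y is a subsemilattice of X having an identity element eY (of its own) *)
Definition subsemilattice1 (X : Semilattice1) (Y : X -> Prop) (eY : X) : Prop :=
  Y eY /\ (forall a b, Y a -> Y b -> Y (smul X a b)) /\
  (forall a, Y a -> smul X eY a = a).

Definition condA (T : Monoid) (X : Semilattice1) (act : T -> X -> X) (Y : X -> Prop) :=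
  forall t e f, Y e -> Y f -> sle X e f -> Y (act t f) -> Y (act t e).

Definition condB (T : Monoid) (X : Semilattice1) (act : T -> X -> X) (Y : X -> Prop) :=
  forall t, exists g, Y g /\ Y (act t g).

(* ---------- Biunary monoids, *-left Ehresmann monoids ---------- *)
Record BiMonoid := {
  bcar :> Type;
  bmul : bcar -> bcar -> bcar;
  bone : bcar;
  bplus : bcar -> bcar;
  bstar : bcar -> bcar }.

Section Ehresmann.
Variable Q : BiMonoid.
Local Notation "x * y" := (bmul Q x y).
Local Notation "x ^+" := (bplus Q x) (at level 2).
Local Notation "x ^*" := (bstar Q x) (at level 2).

Definition star_left_ehresmann : Prop :=
  (forall a b c, a * (b * c) = (a * b) * c) /\
  (forall a, bone Q * a = a) /\ (forall a, a * bone Q = a) /\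
  (forall x, x^+ * x = x) /\
  (forall x y, (x^+ * y^+)^+ = x^+ * y^+) /\
  (forall x y, x^+ * y^+ = y^+ * x^+) /\
  (forall x y, (x * y)^+ = (x * y^+)^+) /\
  (forall x, x * x^* = x) /\
  (forall x, (x^*)^* = x^*) /\
  (forall x y, x^* * y^* = y^* * x^*) /\
  (forall x y, (x * y^*)^* * y^* = (x * y^*)^*) /\
  (forall x, (x^*)^+ = x^*) /\
  (forall x, (x^+)^* = x^+).

(* semilattice of projections E = {a^+} *)
Definition projE (e : Q) : Prop := exists a, e = a^+.
Definition ele (e f : Q) : Prop := e * f = e.
Definition elt (e f : Q) : Prop := ele e f /\ e <> f.

(* congruences and sigma *)
Definition monoid_congruence (R : Q -> Q -> Prop) : Prop :=
  (forall a, R a a) /\ (forall a b, R a b -> R b a) /\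
  (forall a b c, R a b -> R b c -> R a c) /\
  (forall a b c d, R a b -> R c d -> R (a * c) (b * d)).

Definition sigma (a b : Q) : Prop :=
  forall R, monoid_congruence R -> (forall e f, projE e -> projE f -> R e f) -> R a b.

Variable H : Q -> Prop.

Definition atomic : Prop :=
  (forall e, projE e -> H e) /\
  (forall h e, H h -> projE e -> H (h * e) /\ (h * e)^* = h^* * e) /\
  (forall h k, H h -> H k -> ~ projE k -> ele (k^+) (h^*) ->
      H (h * k) /\ (h * k)^* = k^*) /\
  (forall m, exists h, H h /\ sigma m h) /\
  (forall h k w, H h -> H k -> H w -> sigma (h * k) w -> k^* = w^* ->
      exists u, H u /\ sigma u h /\ ele (k^+) (u^*)).

Definition proper_set : Prop :=
  forall h k, H h -> H k -> ((h^* = k^* /\ sigma h k) <-> h = k).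

Definition prodQ (l : list Q) : Q := fold_right (fun a b => a * b) (bone Q) l.

(* h_1 ... h_n (n >= 1) in H-canonical form *)
Fixpoint canonical (l : list Q) : Prop :=
  match l with
  | [] => False
  | [h] => H h
  | h :: ((k :: _) as rest) => H h /\ elt (h^*) (k^+) /\ ~ projE k /\ canonical rest
  end.

Definition has_canonical_forms : Prop :=
  forall q, exists! l, canonical l /\ prodQ l = q.

Definition generates_semigroup : Prop :=
  forall q, exists l, l <> [] /\ Forall H l /\ prodQ l = q.

Definition proper_basis : Prop :=
  atomic /\ proper_set /\ generates_semigroup /\ has_canonical_forms.

End Ehresmann.

(* ---------- P_l(T,X) ---------- *)
Section Pl.
Variables (T : Monoid) (X : Semilattice1) (act : T -> X -> X).

(* letters of the semigroup free product T*X; words are nonempty lists *)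
Definition letter := (T + X)%type.

(* action of T*X on X *)
Fixpoint actw (w : list letter) (x : X) : X :=
  match w with
  | [] => x
  | inl t :: w' => act t (actw w' x)
  | inr e :: w' => smul X e (actw w' x)
  end.

Definition wplus (w : list letter) : X := actw w (sone X).

(* generating pairs: free product relations, (alpha^+ alpha, alpha), (1_T,1_X) *)
Inductive pl_gen : list letter -> list letter -> Prop :=
  | gen_T : forall t t', pl_gen [inl t; inl t'] [inl (mmul T t t')]
  | gen_X : forall x y, pl_gen [inr x; inr y] [inr (smul X x y)]
  | gen_plus : forall w, w <> [] -> pl_gen (inr (wplus w) :: w) w
  | gen_one : pl_gen [inl (mone T)] [inr (sone X)].

(* the semigroup congruence generated (on the free semigroup over T+X) *)
Inductive pl_eq : list letter -> list letter -> Prop :=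
  | pl_refl : forall w, pl_eq w w
  | pl_sym : forall u v, pl_eq u v -> pl_eq v u
  | pl_trans : forall u v w, pl_eq u v -> pl_eq v w -> pl_eq u w
  | pl_step : forall u a b v, pl_gen a b -> pl_eq (u ++ a ++ v) (u ++ b ++ v).

Definition pairs_word (ps : list (X * T)) : list letter :=
  flat_map (fun p => [inr (fst p); inl (snd p)]) ps.

(* t0 e1 t1 ... en tn *)
Definition nf_word (t0 : T) (ps : list (X * T)) : list letter :=
  inl t0 :: pairs_word ps.

Fixpoint nf_ok (ps : list (X * T)) : Prop :=
  match ps with
  | [] => True
  | (e, t) :: rest =>
      e <> sone X /\ (rest <> [] -> t <> mone T) /\
      slt X e (wplus (inl t :: pairs_word rest)) /\ nf_ok rest
  end.

(* [w]^* = [e] in P_l(T,X), computed from the T-normal form of [w] *)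
Definition pl_star (w : list letter) (e : X) : Prop :=
  exists t0 ps, pl_eq w (nf_word t0 ps) /\ nf_ok ps /\
    ((ps = [] /\ e = sone X) \/
     (exists ps' en tn, ps = ps' ++ [(en, tn)] /\
        ((tn = mone T /\ e = en) \/ (tn <> mone T /\ e = sone X)))).

(* Q_l(T,X,Y): subsemigroup of P_l(T,X) generated by {te : e in Y, t.e in Y},
   as a set of words closed under pl_eq *)
Inductive inQl (Y : X -> Prop) : list letter -> Prop :=
  | Ql_gen : forall t e, Y e -> Y (act t e) -> inQl Y [inl t; inr e]
  | Ql_mul : forall u v, inQl Y u -> inQl Y v -> inQl Y (u ++ v)
  | Ql_eq : forall u v, inQl Y u -> pl_eq u v -> inQl Y v.

(* Q_l is a biunary monoid subsemigroup of P_l *)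
Definition Ql_biunary_monoid (Y : X -> Prop) : Prop :=
  (forall w, inQl Y w -> inQl Y [inr (wplus w)]) /\
  (forall w e, inQl Y w -> pl_star w e -> inQl Y [inr e]) /\
  (exists i, inQl Y i /\ forall w, inQl Y w -> pl_eq (i ++ w) w /\ pl_eq (w ++ i) w).

End Pl.

(* Main.v *)
Require Import Defs.
From Stdlib Require Import List.
From Stdlib Require Import Classical ClassicalEpsilon IndefiniteDescription
  FunctionalExtensionality PropExtensionality ProofIrrelevance.
Import ListNotations.

(** By properness [h] in [H] is determined by [pi h] and [h^*], so [H] encodes a
    partial action of [T] on [E] in which [pi h] sends [h^*] to [h^+].  The axioms
    H2, H3 and H5 make it order-preserving, with domains that are lower sets, and
    strong: if [t e] and [(s t) e] are defined then so is [s (t e)].  It therefore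
    extends to a global action on the poset obtained from [T x E] by identifying
    [(s t, e)] with [(s, t e)].  The semilattice [X] consists of the lower sets of
    this poset under intersection, and [e] in [E] becomes its principal lower set;
    strongness ensures that this embedding preserves meets and that [t e] lies in
    the image of [E] only where the partial action was defined.

    An [H]-canonical form [h_1 ... h_n] is sent to the word
    [pi h_1, h_1^*, ..., pi h_n, h_n^*], which is a [T]-normal form up to units.
    Normal forms in [P_l(T,X)] are unique because the letters act on them
    compatibly with the defining relations, and products of elements of [H] reduce
    to canonical form by relations that also hold in [P_l(T,X)]. *)

(** * Normal forms in [P_l(T,X)] *)

Section SemilatticeOrder.
Variable X : Semilattice1.

Lemma s_rid (a : X) : smul X a (sone X) = a.
Proof. now rewrite s_comm, s_lid. Qed.

Lemma sle_refl (a : X) : sle X a a.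
Proof. apply s_idem. Qed.

Lemma sle_antisym (a b : X) : sle X a b -> sle X b a -> a = b.
Proof. unfold sle; intros ab ba; rewrite <- ab, s_comm; exact ba. Qed.

Lemma sle_one (a : X) : sle X a (sone X).
Proof. apply s_rid. Qed.

Lemma smul_sle_r (a b : X) : sle X (smul X a b) b.
Proof. unfold sle; now rewrite <- s_assoc, s_idem. Qed.

Lemma smul_sle_compat (a b c : X) : sle X b c -> sle X (smul X a b) (smul X a c).
Proof.
  unfold sle; intros bc.
  rewrite (s_comm X a c), <- s_assoc, (s_assoc X b c a), bc.
  now rewrite (s_comm X b a), s_assoc, s_idem.
Qed.

Lemma slt_neq_one (a b : X) : slt X a b -> a <> sone X.
Proof.
  intros [ab nab] a1; apply nab; subst a.
  apply sle_antisym; [exact ab | apply sle_one].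
Qed.

End SemilatticeOrder.

Section NormalForms.
Variables (T : Monoid) (X : Semilattice1) (act : T -> X -> X).
Hypothesis Hact : ol_action T X act.

Local Notation word := (list (letter T X)).
Local Notation "u ≈ v" := (pl_eq T X act u v) (at level 70).
Local Notation actw := (actw T X act).
Local Notation wplus := (wplus T X act).
Local Notation nform := (T * list (X * T))%type.
Local Notation nf_ok := (nf_ok T X act).

(** * Calculus of words modulo the congruence *)

Lemma pl_eq_ctx (a u v b : word) : u ≈ v -> a ++ u ++ b ≈ a ++ v ++ b.
Proof.
  induction 1 as [w | u v _ IH | u v w _ IH1 _ IH2 | u c d v cd].
  - apply pl_refl.
  - now apply pl_sym.
  - now apply pl_trans with (a ++ v ++ b).
  - rewrite <- !app_assoc, !(app_assoc a u); now apply pl_step.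
Qed.

Lemma pl_eq_app (u u' v v' : word) : u ≈ u' -> v ≈ v' -> u ++ v ≈ u' ++ v'.
Proof.
  intros uu vv; apply pl_trans with (u' ++ v).
  - exact (pl_eq_ctx [] u u' v uu).
  - rewrite <- (app_nil_r v), <- (app_nil_r v'); now apply pl_eq_ctx.
Qed.

Lemma pl_eq_cons (a : letter T X) (u v : word) : u ≈ v -> a :: u ≈ a :: v.
Proof. intros uv; apply (pl_eq_app [a] [a]); [apply pl_refl | exact uv]. Qed.

Lemma pl_eq_gen_app (a b v : word) : pl_gen T X act a b -> a ++ v ≈ b ++ v.
Proof. exact (pl_step T X act [] a b v). Qed.

Lemma pl_mulX (x y : X) (v : word) : inr x :: inr y :: v ≈ inr (smul X x y) :: v.
Proof. exact (pl_eq_gen_app _ _ v (gen_X T X act x y)). Qed.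

Lemma pl_mulT (s t : T) (v : word) : inl s :: inl t :: v ≈ inl (mmul T s t) :: v.
Proof. exact (pl_eq_gen_app _ _ v (gen_T T X act s t)). Qed.

Lemma pl_plus (u v : word) : u <> [] -> inr (wplus u) :: u ++ v ≈ u ++ v.
Proof. intros nu; exact (pl_eq_gen_app _ _ v (gen_plus T X act u nu)). Qed.

Lemma pl_one (v : word) : inl (mone T) :: v ≈ inr (sone X) :: v.
Proof. exact (pl_eq_gen_app _ _ v (gen_one T X act)). Qed.

(** Words stand for elements of a semigroup, so the unit letter is cancelled only against a
    neighbour; next to a letter of [X] it is first turned into [1_X]. *)
Lemma pl_one_l (a : letter T X) (v : word) : inl (mone T) :: a :: v ≈ a :: v.
Proof.
  destruct a as [t | x].
  - rewrite <- (m_lid T t) at 2; apply pl_mulT.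
  - eapply pl_trans; [apply pl_one|].
    rewrite <- (s_lid X x) at 2; apply pl_mulX.
Qed.

Lemma pl_one_r (a : letter T X) : [a; inl (mone T)] ≈ [a].
Proof.
  destruct a as [t | x].
  - rewrite <- (m_rid T t) at 2; apply pl_mulT.
  - eapply pl_trans; [apply pl_eq_cons, pl_one|].
    rewrite <- (s_rid X x) at 2; apply pl_mulX.
Qed.

Lemma actw_app (u v : word) (x : X) : actw (u ++ v) x = actw u (actw v x).
Proof.
  induction u as [| [t | e] u IH]; simpl; [reflexivity | |]; now rewrite IH.
Qed.

Lemma actw_sle (w : word) (x y : X) : sle X x y -> sle X (actw w x) (actw w y).
Proof.
  intros xy; induction w as [| [t | e] w IH]; simpl; [exact xy | |].
  - now apply Hact.
  - now apply smul_sle_compat.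
Qed.

Lemma actw_sle_wplus (w : word) (x : X) : sle X (actw w x) (wplus w).
Proof. apply actw_sle, sle_one. Qed.

Lemma actw_pl_eq (u v : word) : u ≈ v -> forall x, actw u x = actw v x.
Proof.
  destruct Hact as [act1 [actM _]].
  induction 1 as [w | u v _ IH | u v w _ IH1 _ IH2 | u c d v cd]; intros x.
  - reflexivity.
  - now rewrite IH.
  - now rewrite IH1, IH2.
  - rewrite !actw_app; f_equal.
    generalize (actw v x); clear x; intros x.
    destruct cd; simpl.
    + now rewrite actM.
    + apply s_assoc.
    + rewrite s_comm; apply actw_sle_wplus.
    + now rewrite act1, s_lid.
Qed.

Lemma wplus_pl_eq (u v : word) : u ≈ v -> wplus u = wplus v.
Proof. intros uv; now apply actw_pl_eq. Qed.

(** * The action of words on normal forms *)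

Definition nf_plus (n : nform) : X := wplus (nf_word T X (fst n) (snd n)).

(* The part of a normal form that stays untouched when an element of [X] is
   multiplied in from the left. *)
Definition nf_tail (n : nform) : nform :=
  match n with
  | (t, []) => n
  | (t, (_, t1) :: ps) =>
      if excluded_middle_informative (t = mone T) then (t1, ps) else n
  end.

(** Left multiplication on normal forms. It is defined on arbitrary pairs, not only on those
    satisfying [nf_ok], so the relations can be checked without carrying an invariant. *)
Definition nf_letter (a : letter T X) (n : nform) : nform :=
  match a with
  | inl t => (mmul T t (fst n), snd n)
  | inr x =>
      if excluded_middle_informative (smul X x (nf_plus n) = nf_plus n) then n
      else (mone T, (smul X x (nf_plus n), fst (nf_tail n)) :: snd (nf_tail n))
  end.

Definition nf_act (w : word) (n : nform) : nform := fold_right nf_letter n w.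

Lemma nf_plus_cons (t t1 : T) (e : X) (ps : list (X * T)) :
  nf_plus (t, (e, t1) :: ps) = act t (smul X e (nf_plus (t1, ps))).
Proof. reflexivity. Qed.

(** This is why the move in [nf_letter] may discard a leading projection: the new entry [x n^+]
    already lies below the projection of the tail. *)
Lemma nf_plus_sle_tail (n : nform) : sle X (nf_plus n) (nf_plus (nf_tail n)).
Proof.
  destruct n as [t [| [e t1] ps]]; simpl; [apply sle_refl|].
  destruct (excluded_middle_informative _) as [t_one | _]; [|apply sle_refl].
  rewrite t_one, nf_plus_cons, (proj1 Hact).
  apply smul_sle_r.
Qed.

Lemma nf_plus_letter (a : letter T X) (n : nform) :
  nf_plus (nf_letter a n) = actw [a] (nf_plus n).
Proof.
  destruct Hact as [act1 [actM _]].
  destruct a as [t | x]; simpl.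
  - unfold nf_plus; simpl; apply actM.
  - destruct (excluded_middle_informative _) as [eq | _]; [now rewrite eq|].
    rewrite nf_plus_cons, act1, <- surjective_pairing, <- s_assoc.
    now rewrite (nf_plus_sle_tail n).
Qed.

Lemma nf_tail_letter (x : X) (n : nform) : nf_tail (nf_letter (inr x) n) = nf_tail n.
Proof.
  simpl; destruct (excluded_middle_informative _); [reflexivity|].
  simpl; destruct (excluded_middle_informative _) as [_ | no]; [|now elim no].
  now rewrite <- surjective_pairing.
Qed.

Lemma nf_act_app (u v : word) (n : nform) : nf_act (u ++ v) n = nf_act u (nf_act v n).
Proof. apply fold_right_app. Qed.

Lemma nf_plus_act (w : word) (n : nform) : nf_plus (nf_act w n) = actw w (nf_plus n).
Proof.
  induction w as [| a w IH]; [reflexivity|].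
  change (nf_plus (nf_letter a (nf_act w n)) = actw ([a] ++ w) (nf_plus n)).
  now rewrite nf_plus_letter, actw_app, IH.
Qed.

Lemma nf_letter_fix (x : X) (n : nform) :
  smul X x (nf_plus n) = nf_plus n -> nf_letter (inr x) n = n.
Proof.
  intros eq; simpl; destruct (excluded_middle_informative _); [reflexivity | contradiction].
Qed.

Lemma nf_letter_move (x : X) (n : nform) :
  smul X x (nf_plus n) <> nf_plus n ->
  nf_letter (inr x) n =
    (mone T, (smul X x (nf_plus n), fst (nf_tail n)) :: snd (nf_tail n)).
Proof.
  intros neq; simpl; destruct (excluded_middle_informative _); [contradiction | reflexivity].
Qed.

Lemma nf_letter_mulX (x y : X) (n : nform) :
  nf_letter (inr x) (nf_letter (inr y) n) = nf_letter (inr (smul X x y)) n.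
Proof.
  destruct (classic (smul X y (nf_plus n) = nf_plus n)) as [yf | yf].
  - rewrite (nf_letter_fix y n yf); simpl.
    now rewrite <- s_assoc, yf.
  - assert (P : nf_plus (nf_letter (inr y) n) = smul X y (nf_plus n))
      by apply nf_plus_letter.
    (* If [smul X x y] fixed the projection of [n], so would the larger element [y]. *)
    assert (xyf : smul X (smul X x y) (nf_plus n) <> nf_plus n).
    { intros eq; apply yf; rewrite <- eq at 1.
      rewrite (s_comm X x y), !s_assoc, s_idem; rewrite <- eq at 2.
      now rewrite (s_comm X x y). }
    rewrite (nf_letter_move _ n xyf).
    destruct (classic (smul X x (nf_plus (nf_letter (inr y) n)) =
                         nf_plus (nf_letter (inr y) n))) as [xf | xf].
    + rewrite (nf_letter_fix _ _ xf), (nf_letter_move _ n yf).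
      rewrite P in xf; now rewrite <- s_assoc, xf.
    + now rewrite (nf_letter_move _ _ xf), nf_tail_letter, P, s_assoc.
Qed.

Lemma nf_act_pl_eq (u v : word) : u ≈ v -> forall n, nf_act u n = nf_act v n.
Proof.
  induction 1 as [w | u v _ IH | u v w _ IH1 _ IH2 | u c d v cd]; intros n.
  - reflexivity.
  - now rewrite IH.
  - now rewrite IH1, IH2.
  - rewrite !nf_act_app; f_equal.
    generalize (nf_act v n); clear n; intros n.
    destruct cd as [t t' | x y | w _ |].
    + simpl; now rewrite m_assoc.
    + apply nf_letter_mulX.
    + apply nf_letter_fix.
      (* The projection of [nf_act w n] is the image under [w] of that of [n], hence below
         [wplus w]; the letter [wplus w] therefore fixes the form. *)
      fold (nf_act w n); rewrite nf_plus_act, s_comm; apply actw_sle_wplus.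
    + unfold nf_act, fold_right; rewrite (nf_letter_fix (sone X)) by apply s_lid.
      simpl; now rewrite m_lid, <- surjective_pairing.
Qed.

(** Acting on the trivial form rebuilds a normal form letter by letter: strictness of the inequality
    forces the moving branch, and a nontrivial inner [t1] makes [nf_tail] leave the rest intact.
    Uniqueness follows as in van der Waerden's argument for free products. *)
Lemma nf_act_nf_word (t : T) (ps : list (X * T)) :
  nf_ok ps -> nf_act (nf_word T X t ps) (mone T, []) = (t, ps).
Proof.
  revert t; induction ps as [| [e t1] ps IH]; intros t ok.
  - simpl; now rewrite m_rid.
  - destruct ok as [_ [t1_ne [[le ne] ok]]].
    change (nf_letter (inl t) (nf_letter (inr e)
              (nf_act (nf_word T X t1 ps) (mone T, []))) = (t, (e, t1) :: ps)).
    rewrite (IH t1 ok).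
    assert (eq : smul X e (nf_plus (t1, ps)) = e) by exact le.
    rewrite nf_letter_move by (rewrite eq; exact ne).
    rewrite eq.
    assert (tl : nf_tail (t1, ps) = (t1, ps)).
    { destruct ps as [| [e2 t2] ps]; simpl; [reflexivity|].
      destruct (excluded_middle_informative _); [|reflexivity].
      now elim t1_ne. }
    rewrite tl; simpl; now rewrite m_rid.
Qed.

Lemma nf_word_unique (t s : T) (ps qs : list (X * T)) : nf_ok ps -> nf_ok qs ->
  nf_word T X t ps ≈ nf_word T X s qs -> t = s /\ ps = qs.
Proof.
  intros okp okq eq.
  assert (E := nf_act_pl_eq _ _ eq (mone T, [])).
  rewrite !nf_act_nf_word in E by assumption.
  now injection E.
Qed.

Lemma pl_star_pl_eq (u v : word) (e : X) :
  u ≈ v -> pl_star T X act u e -> pl_star T X act v e.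
Proof.
  intros uv (t & ps & eq & st); exists t, ps; split; [|exact st].
  now apply pl_trans with u; [apply pl_sym|].
Qed.

Lemma pl_star_unique (w : word) (e f : X) :
  pl_star T X act w e -> pl_star T X act w f -> e = f.
Proof.
  intros (t & ps & eq & ok & st) (t' & ps' & eq' & ok' & st').
  destruct (nf_word_unique t t' ps ps' ok ok') as [_ <-].
  { now apply pl_trans with w; [apply pl_sym|]. }
  destruct st as [[-> ->] | (qs & x & s & -> & st)];
  destruct st' as [[E ->] | (qs' & x' & s' & E & st')].
  - reflexivity.
  - now destruct qs'.
  - now destruct qs.
  - apply app_inj_tail in E; destruct E as [_ E]; injection E as -> ->.
    destruct st as [[] | []]; destruct st' as [[] | []]; subst; tauto.
Qed.

End NormalForms.

(** * The semilattice on which [Q/sigma] acts *)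

Section Globalisation.
Variables (Q : BiMonoid) (H : Q -> Prop).
Hypotheses (HQ : star_left_ehresmann Q) (HH : proper_basis Q H).
Variables (T : Monoid) (pi : Q -> T).
Hypothesis pi_mul : forall a b, pi (bmul Q a b) = mmul T (pi a) (pi b).
Hypothesis pi_one : pi (bone Q) = mone T.
Hypothesis pi_surj : forall t : T, exists q, pi q = t.
Hypothesis pi_ker : forall a b, pi a = pi b <-> sigma Q a b.

Local Infix "*" := (bmul Q).
Local Notation "1" := (bone Q).
Local Notation "x ^+" := (bplus Q x) (at level 2).
Local Notation "x ^*" := (bstar Q x) (at level 2).
Local Notation E := (projE Q).
Local Infix "≤" := (ele Q) (at level 70).

(** * Arithmetic of projections *)

Lemma bmulA (a b c : Q) : a * (b * c) = a * b * c.
Proof. apply HQ. Qed.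

Lemma bmul1l (a : Q) : 1 * a = a.
Proof. apply HQ. Qed.

Lemma bmul1r (a : Q) : a * 1 = a.
Proof. apply HQ. Qed.

Lemma plus_mul (x : Q) : x^+ * x = x.
Proof. apply HQ. Qed.

Lemma mul_star (x : Q) : x * x^* = x.
Proof. apply HQ. Qed.

Lemma plus_mul_plus (x y : Q) : (x * y)^+ = (x * y^+)^+.
Proof. apply HQ. Qed.

Lemma plusM (x y : Q) : (x^+ * y^+)^+ = x^+ * y^+.
Proof. apply HQ. Qed.

Lemma plus_star (x : Q) : (x^*)^+ = x^*.
Proof. apply HQ. Qed.

Lemma star_plus (x : Q) : (x^+)^* = x^+.
Proof. apply HQ. Qed.

Lemma plusK (x : Q) : (x^+)^+ = x^+.
Proof. now rewrite <- (star_plus x), plus_star. Qed.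

Lemma E_plus (x : Q) : E x^+.
Proof. now exists x. Qed.

Lemma E_star (x : Q) : E x^*.
Proof. exists x^*; now rewrite plus_star. Qed.

Lemma E_plus_id (e : Q) : E e -> e^+ = e.
Proof. intros [a ->]; apply plusK. Qed.

Lemma E_star_id (e : Q) : E e -> e^* = e.
Proof. intros [a ->]; apply star_plus. Qed.

Lemma E_mul (e f : Q) : E e -> E f -> E (e * f).
Proof. intros [a ->] [b ->]; exists (a^+ * b^+); now rewrite plusM. Qed.

Lemma E_comm (e f : Q) : E e -> E f -> e * f = f * e.
Proof. intros [a ->] [b ->]; apply HQ. Qed.

Lemma E_idem (e : Q) : E e -> e * e = e.
Proof. intros Ee; rewrite <- (E_plus_id e Ee) at 1; apply plus_mul. Qed.

Lemma one_plus : 1^+ = 1.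
Proof. rewrite <- (bmul1r 1^+); apply plus_mul. Qed.

Lemma E_one : E 1.
Proof. rewrite <- one_plus; apply E_plus. Qed.

Lemma ele_refl (e : Q) : E e -> e ≤ e.
Proof. apply E_idem. Qed.

Lemma ele_trans (e f g : Q) : e ≤ f -> f ≤ g -> e ≤ g.
Proof.
  unfold ele; intros ef fg; rewrite <- ef at 1; now rewrite <- bmulA, fg.
Qed.

Lemma ele_antisym (e f : Q) : E e -> E f -> e ≤ f -> f ≤ e -> e = f.
Proof. unfold ele; intros Ee Ef ef fe; rewrite <- ef, E_comm; auto. Qed.

Lemma ele_mul_r (e f : Q) : E f -> e * f ≤ f.
Proof. intros Ef; unfold ele; now rewrite <- bmulA, E_idem. Qed.

Lemma ele_mul_l (e f : Q) : E e -> E f -> e * f ≤ e.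
Proof. intros Ee Ef; rewrite E_comm by assumption; now apply ele_mul_r. Qed.

Lemma ele_mul_glb (e f g : Q) : g ≤ e -> g ≤ f -> g ≤ e * f.
Proof. unfold ele; intros ge gf; now rewrite bmulA, ge. Qed.

Lemma plus_mul_le (x y : Q) : (x * y)^+ ≤ x^+.
Proof.
  unfold ele; rewrite E_comm by apply E_plus.
  rewrite <- plusM, <- plus_mul_plus, bmulA, plus_mul; reflexivity.
Qed.

Lemma pi_E (e : Q) : E e -> pi e = mone T.
Proof.
  intros Ee; rewrite <- pi_one; apply pi_ker.
  intros R _ HR; apply HR; [exact Ee | exact E_one].
Qed.

(** * The partial action of [T] on [E] encoded by [H] *)

Lemma H_E (e : Q) : E e -> H e.
Proof. apply HH. Qed.

Lemma H_mulE (h e : Q) : H h -> E e -> H (h * e) /\ (h * e)^* = h^* * e.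
Proof. apply HH. Qed.

Lemma H_inj (h k : Q) : H h -> H k -> pi h = pi k -> h^* = k^* -> h = k.
Proof. intros Hh Hk p s; apply (proj1 (proj1 (proj2 HH) h k Hh Hk)); split; [exact s | now apply pi_ker]. Qed.

Lemma H_pi_one (h : Q) : H h -> pi h = mone T -> E h.
Proof.
  intros Hh p; rewrite (H_inj h h^*); [apply E_star | exact Hh | | |].
  - apply H_E, E_star.
  - now rewrite (pi_E h^* (E_star h)).
  - now rewrite (E_star_id _ (E_star h)).
Qed.

Lemma pi_mulE (h e : Q) : E e -> pi (h * e) = pi h.
Proof. intros Ee; now rewrite pi_mul, (pi_E e Ee), m_rid. Qed.

(** Composition of the partial action. H3 excludes [k] in [E]; that case comes from H2. *)
Lemma H_mul (h k : Q) : H h -> H k -> h^* = k^+ ->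
  H (h * k) /\ (h * k)^* = k^* /\ (h * k)^+ = h^+.
Proof.
  intros Hh Hk hk.
  assert (P : (h * k)^+ = h^+) by now rewrite plus_mul_plus, <- hk, mul_star.
  destruct (classic (E k)) as [Ek | nEk].
  - destruct (H_mulE h k Hh Ek) as [Hhk S].
    repeat split; auto.
    now rewrite S, hk, E_plus_id, E_star_id, E_idem.
  - destruct (proj1 (proj2 (proj2 (proj1 HH))) h k Hh Hk nEk) as [Hhk S]; auto.
    unfold ele; rewrite <- hk; apply E_idem, E_star.
Qed.

(** Order preservation: [h] is first restricted to [k^+], which can only lower [h^+]. *)
Lemma H_mul_restrict (h k : Q) : H h -> H k -> k^+ ≤ h^* ->
  exists w, H w /\ pi w = mmul T (pi h) (pi k) /\ w^* = k^* /\ w^+ ≤ h^+.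
Proof.
  intros Hh Hk le.
  destruct (H_mulE h k^+ Hh (E_plus k)) as [H1 S1].
  assert (S1' : (h * k^+)^* = k^+).
  { rewrite S1, E_comm; [exact le | apply E_star | apply E_plus]. }
  destruct (H_mul (h * k^+) k H1 Hk S1') as (Hw & Sw & Pw).
  exists (h * k^+ * k); repeat split; auto.
  - rewrite pi_mul, pi_mulE; [reflexivity | apply E_plus].
  - rewrite Pw; apply plus_mul_le.
Qed.

(* Lower sets of the quotient of [T x E] described at the top, taken as subsets of
   [T x Q]; the values at second components outside [E] play no role. *)
Definition closed (A : T -> Q -> Prop) : Prop :=
  (forall s g g', A s g -> E g' -> g' ≤ g -> A s g') /\
  (forall s k, H k -> (A (mmul T s (pi k)) k^* <-> A s k^+)).

Definition lset : Type := {A : T -> Q -> Prop | closed A}.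

Definition lset_in (A : lset) (s : T) (g : Q) : Prop := proj1_sig A s g.

Lemma lset_ext (A B : lset) : (forall s g, lset_in A s g <-> lset_in B s g) -> A = B.
Proof.
  destruct A as [A cA], B as [B cB]; unfold lset_in; simpl; intros AB.
  assert (EAB : A = B).
  { apply functional_extensionality; intros s.
    apply functional_extensionality; intros g.
    apply propositional_extensionality, AB. }
  subst B; f_equal; apply proof_irrelevance.
Qed.

Lemma closed_meet (A B : lset) : closed (fun s g => lset_in A s g /\ lset_in B s g).
Proof.
  destruct A as [A [dA eA]], B as [B [dB eB]]; unfold lset_in; simpl; split.
  - intros s g g' [a b] Eg le; split; eauto.
  - intros s k Hk; now rewrite eA, eB.
Qed.

Lemma closed_top : closed (fun _ _ => True).
Proof. now split. Qed.

Definition lset_semilattice : Semilattice1.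
Proof.
  refine {| scar := lset;
            smul := fun A B => exist closed _ (closed_meet A B);
            sone := exist closed _ closed_top |};
  intros; apply lset_ext; unfold lset_in; simpl; tauto.
Defined.

Local Notation X := lset_semilattice.

Lemma lset_sle (A B : X) : sle X A B <-> (forall s g, lset_in A s g -> lset_in B s g).
Proof.
  split.
  - intros AB s g; rewrite <- AB; now intros [].
  - intros AB; apply lset_ext; intros s g; unfold lset_in at 1; simpl.
    split; [tauto | auto].
Qed.

(** * The global action on lower sets *)

Lemma closed_translate (t : T) (A : T -> Q -> Prop) :
  closed A -> closed (fun s g => A (mmul T t s) g).
Proof.
  intros [dA eA]; split.
  - intros s g g'; apply dA.
  - intros s k Hk; rewrite m_assoc; now apply eA.
Qed.

(** The least closed set containing the translate of [A] by [t], as an intersection. The translate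
    itself need not be closed, since the product of [s] and [pi k] may be a left multiple by [t]
    when [s] is not. *)
Definition lact_set (t : T) (A : lset) (s : T) (g : Q) : Prop :=
  forall B, closed B -> (forall r f, lset_in A r f -> B (mmul T t r) f) -> B s g.

Lemma closed_lact (t : T) (A : lset) : closed (lact_set t A).
Proof.
  split.
  - intros s g g' a Eg le B cB tAB.
    apply (proj1 cB s g g'); auto; now apply a.
  - intros s k Hk; split; intros a B cB tAB; apply (proj2 cB s k Hk); now apply a.
Qed.

Definition lact (t : T) (A : X) : X := exist closed _ (closed_lact t A).

Lemma lset_in_lact (t : T) (A : X) (r : T) (f : Q) :
  lset_in A r f -> lset_in (lact t A) (mmul T t r) f.
Proof. intros a B cB tAB; now apply tAB. Qed.

Lemma lact_sub (t : T) (A B : X) :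
  (forall r f, lset_in A r f -> lset_in B (mmul T t r) f) ->
  forall s g, lset_in (lact t A) s g -> lset_in B s g.
Proof. intros AB s g a; exact (a _ (proj2_sig B) AB). Qed.

Lemma lact_ol_action : ol_action T X lact.
Proof.
  split; [|split].
  - intros A; apply lset_ext; intros s g; split.
    + apply lact_sub; intros r f; now rewrite m_lid.
    + intros a; rewrite <- (m_lid T s); now apply lset_in_lact.
  - intros t u A; apply lset_ext; intros s g; split.
    + apply lact_sub; intros r f a; rewrite <- m_assoc.
      now apply lset_in_lact, lset_in_lact.
    + apply lact_sub; intros r f a.
      (* The test set is the preimage, under translation by [t], of the lower set obtained from [A]
         by [mmul T t u]. *)
      apply (a (fun s g => lset_in (lact (mmul T t u) A) (mmul T t s) g)).
      * exact (closed_translate t _ (proj2_sig (lact (mmul T t u) A))).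
      * intros r' f' a'; rewrite m_assoc; now apply lset_in_lact.
  - intros t A B; rewrite !lset_sle; intros AB.
    apply lact_sub; intros r f a; apply lset_in_lact; auto.
Qed.

(** * The embedding of [E] *)

Definition theta_set (e : Q) (s : T) (g : Q) : Prop :=
  exists h, H h /\ pi h = s /\ h^* = g /\ h^+ ≤ e.

(** Closure downwards is H2. In the second condition, one direction is composition and the other is
    strongness of the partial action, that is, H5. *)
Lemma closed_theta (e : Q) : closed (theta_set e).
Proof.
  split.
  - intros s g g' (h & Hh & ph & sh & le) Eg le'.
    destruct (H_mulE h g' Hh Eg) as [Hhg S].
    exists (h * g'); repeat split; auto.
    + now rewrite pi_mulE.
    + rewrite S, sh, E_comm; auto; rewrite <- sh; apply E_star.
    + apply ele_trans with h^+; [apply plus_mul_le | exact le].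
  - intros s k Hk; split.
    + intros (w & Hw & pw & sw & le).
      (* H4 lifts [s] to some [h0] in [H], and H5 replaces it by a [u] over [s] with [k^+] below
         [u^*]. Restricting [u] to [k^+] gives the witness, whose product with [k] is [w] by
         properness. *)
      destruct (pi_surj s) as [q pq].
      destruct (proj1 (proj2 (proj2 (proj2 (proj1 HH)))) q) as (h0 & Hh0 & qh0).
      apply pi_ker in qh0.
      destruct (proj2 (proj2 (proj2 (proj2 (proj1 HH)))) h0 k w Hh0 Hk Hw)
        as (u & Hu & pu & leu).
      { apply pi_ker; now rewrite pw, pi_mul, <- qh0, pq. }
      { now symmetry. }
      apply pi_ker in pu.
      destruct (H_mulE u k^+ Hu (E_plus k)) as [Hh Sh].
      rewrite (E_comm u^*), leu in Sh by (apply E_star || apply E_plus).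
      destruct (H_mul (u * k^+) k Hh Hk Sh) as (Hhk & Shk & Phk).
      assert (ph : pi (u * k^+) = s).
      { rewrite pi_mulE by apply E_plus; congruence. }
      exists (u * k^+); repeat split; auto.
      rewrite <- Phk, (H_inj (u * k^+ * k) w); auto; [|congruence].
      now rewrite pi_mul, ph.
    + intros (h & Hh & ph & sh & le).
      destruct (H_mul h k Hh Hk sh) as (Hhk & Shk & Phk).
      exists (h * k); repeat split; auto.
      * now rewrite pi_mul, ph.
      * now rewrite Phk.
Qed.

Definition theta (e : Q) : X := exist closed _ (closed_theta e).

Lemma theta_self (e : Q) : E e -> lset_in (theta e) (mone T) e.
Proof.
  intros Ee; exists e; repeat split.
  - now apply H_E.
  - now apply pi_E.
  - now apply E_star_id.
  - rewrite E_plus_id by exact Ee; now apply ele_refl.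
Qed.

(** The pair of [1_T] and [e] lies in [theta e]; its witness in [theta f] has image [1_T], so it is
    a projection and equals [e]. *)
Lemma theta_le (e f : Q) : E e -> sle X (theta e) (theta f) -> e ≤ f.
Proof.
  intros Ee; rewrite lset_sle; intros le.
  destruct (le _ _ (theta_self e Ee)) as (h & Hh & ph & sh & hf).
  assert (Eh : E h) by now apply H_pi_one.
  rewrite E_star_id in sh by exact Eh; subst h.
  now rewrite E_plus_id in hf.
Qed.

Lemma theta_inj (e f : Q) : E e -> E f -> theta e = theta f -> e = f.
Proof.
  intros Ee Ef eq; apply ele_antisym; auto; apply theta_le; auto;
    rewrite eq; apply sle_refl.
Qed.

(** By properness, membership in [theta e] and in [theta f] has the same witness, so the two bounds
    combine. *)
Lemma theta_mul (e f : Q) : E e -> E f -> theta (e * f) = smul X (theta e) (theta f).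
Proof.
  intros Ee Ef; apply lset_ext; intros s g; split.
  - intros (h & Hh & ph & sh & le); split; exists h; repeat split; auto.
    + apply ele_trans with (e * f); [exact le | now apply ele_mul_l].
    + apply ele_trans with (e * f); [exact le | now apply ele_mul_r].
  - intros [(h & Hh & ph & sh & le) (h' & Hh' & ph' & sh' & le')].
    assert (h = h') by (apply H_inj; congruence); subst h'.
    exists h; repeat split; auto; now apply ele_mul_glb.
Qed.

(** The global action extends the partial one. *)
Lemma lact_theta (h : Q) : H h -> lact (pi h) (theta h^*) = theta h^+.
Proof.
  intros Hh; apply lset_ext; intros s g; split.
  - apply lact_sub; intros r f (k & Hk & pk & sk & le).
    destruct (H_mul_restrict h k Hh Hk le) as (w & Hw & pw & sw & lew).
    exists w; repeat split; auto; congruence.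
  - intros (k & Hk & <- & <- & le) B cB hB.
    (* Closedness of [B] is used three times: from the pair at [h] back to [h^+] over [1_T], down to
       [k^+], and forward to the pair at [k]. *)
    assert (b1 : B (mone T) h^+).
    { apply (proj2 cB _ h Hh); rewrite m_lid, <- (m_rid T (pi h)).
      apply hB, theta_self, E_star. }
    rewrite <- (m_lid T (pi k)); apply (proj2 cB _ k Hk).
    apply (proj1 cB _ _ _ b1); [apply E_plus | exact le].
Qed.

(** The pair of [t] and [e] belongs to the translate of [theta e], and its membership in [theta f]
    is witnessed by the required element of [H]. *)
Lemma lact_theta_defined (t : T) (e f : Q) : E e -> lact t (theta e) = theta f ->
  exists h, H h /\ pi h = t /\ h^* = e.
Proof.
  intros Ee eq.
  assert (a := lset_in_lact t _ _ _ (theta_self e Ee)).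
  rewrite eq, m_rid in a.
  destruct a as (h & Hh & ph & sh & _); now exists h.
Qed.

Definition imE (x : X) : Prop := exists e, E e /\ theta e = x.

Lemma imE_subsemilattice : subsemilattice1 X imE (theta 1).
Proof.
  split; [|split].
  - exists 1; split; [apply E_one | reflexivity].
  - intros a b (e & Ee & <-) (f & Ef & <-); exists (e * f).
    split; [now apply E_mul | now apply theta_mul].
  - intros a (e & Ee & <-); rewrite <- theta_mul by (exact E_one || exact Ee).
    now rewrite bmul1l.
Qed.

Lemma imE_condA : condA T X lact imE.
Proof.
  intros t x y (e & Ee & <-) (f & Ef & <-) le (g & Eg & eq).
  apply theta_le in le; auto.
  destruct (lact_theta_defined t f g Ef (eq_sym eq)) as (h & Hh & ph & sh).
  destruct (H_mulE h e Hh Ee) as [Hhe S].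
  exists (h * e)^+; split; [apply E_plus|].
  rewrite <- lact_theta, pi_mulE, ph, S, sh by assumption.
  now rewrite E_comm, le.
Qed.

Lemma imE_condB : condB T X lact imE.
Proof.
  intros t; destruct (pi_surj t) as [q <-].
  destruct (proj1 (proj2 (proj2 (proj2 (proj1 HH)))) q) as (h & Hh & qh).
  apply pi_ker in qh; exists (theta h^*); split.
  - exists h^*; split; [apply E_star | reflexivity].
  - exists h^+; split; [apply E_plus | now rewrite qh, lact_theta].
Qed.

(** * Comparing canonical forms with normal forms *)

Local Notation "u ≈ v" := (pl_eq T X lact u v) (at level 70).
Local Notation wplus := (wplus T X lact).

(** * Words attached to lists over [H] *)

Definition hword (l : list Q) : list (letter T X) :=
  flat_map (fun h => [inl (pi h); inr (theta h^*)]) l.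

Lemma hword_app (l l' : list Q) : hword (l ++ l') = hword l ++ hword l'.
Proof. apply flat_map_app. Qed.

Lemma prodQ_app (l l' : list Q) : prodQ Q (l ++ l') = prodQ Q l * prodQ Q l'.
Proof.
  induction l as [| h l IH]; simpl; [now rewrite bmul1l | now rewrite IH, bmulA].
Qed.

(** The factor [theta e] makes the induction start: the empty word has projection [1_X], which may
    lie strictly above [theta 1]. *)
Lemma theta_wplus (l : list Q) : Forall H l ->
  forall e, E e -> smul X (theta e) (wplus (hword l)) = theta (e * (prodQ Q l)^+).
Proof.
  induction 1 as [| h l Hh _ IH]; intros e Ee.
  - change (wplus (hword [])) with (sone X); simpl prodQ.
    now rewrite s_rid, one_plus, bmul1r.
  - change (wplus (hword (h :: l)))
      with (lact (pi h) (smul X (theta h^*) (wplus (hword l)))).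
    rewrite IH by apply E_star; simpl prodQ; rewrite plus_mul_plus.
    assert (Ep := E_plus (prodQ Q l)).
    destruct (H_mulE h _ Hh Ep) as [Hhp S].
    rewrite <- S, <- (pi_mulE h _ Ep), lact_theta by exact Hhp.
    symmetry; apply theta_mul; [exact Ee | apply E_plus].
Qed.

Lemma wplus_hword (l : list Q) : Forall H l -> l <> [] ->
  wplus (hword l) = theta (prodQ Q l)^+.
Proof.
  intros Hl nl; destruct l as [| h l]; [now elim nl|].
  inversion_clear Hl as [| ? ? Hh Hl'].
  change (wplus (hword (h :: l)))
    with (lact (pi h) (smul X (theta h^*) (wplus (hword l)))).
  rewrite theta_wplus by (exact Hl' || apply E_star); simpl prodQ.
  assert (Ep := E_plus (prodQ Q l)).
  destruct (H_mulE h _ Hh Ep) as [Hhp S].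
  rewrite plus_mul_plus, <- S, <- (pi_mulE h _ Ep).
  now apply lact_theta.
Qed.

Lemma hword_plus (k : Q) (v : list (letter T X)) : H k ->
  inr (theta k^+) :: inl (pi k) :: inr (theta k^*) :: v
    ≈ inl (pi k) :: inr (theta k^*) :: v.
Proof.
  intros Hk.
  assert (P := wplus_hword [k] (Forall_cons _ Hk (Forall_nil _))).
  simpl prodQ in P; rewrite bmul1r in P; rewrite <- P by discriminate.
  now apply (pl_plus T X lact (hword [k])).
Qed.

Lemma hword_restrict (h k : Q) (l : list Q) : H k -> H h ->
  hword (h :: k :: l) ≈ hword (h * k^+ :: k :: l).
Proof.
  intros Hk Hh; simpl.
  rewrite (proj2 (H_mulE h k^+ Hh (E_plus k))), pi_mulE by apply E_plus.
  rewrite theta_mul by (apply E_star || apply E_plus).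
  apply pl_eq_cons.
  eapply pl_trans; [|apply pl_mulX].
  apply pl_eq_cons, pl_sym; now apply hword_plus.
Qed.

Lemma hword_mul (h k : Q) (l : list Q) : H h -> H k -> h^* = k^+ ->
  hword (h :: k :: l) ≈ hword (h * k :: l).
Proof.
  intros Hh Hk hk; simpl.
  rewrite (proj1 (proj2 (H_mul h k Hh Hk hk))), pi_mul, hk.
  eapply pl_trans; [apply pl_eq_cons; now apply hword_plus | apply pl_mulT].
Qed.

Lemma hword_E (e : Q) : E e -> hword [e] ≈ [inr (theta e)].
Proof. intros Ee; simpl; rewrite pi_E, E_star_id by exact Ee; apply pl_one_l. Qed.

(** * Reduction to canonical form *)

Definition lstar (l : list Q) : Q := (last l 1)^*.

Lemma canonical_Forall (l : list Q) : canonical Q H l -> Forall H l.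
Proof.
  induction l as [| h [| k l] IH]; simpl; [tauto | auto |].
  intros (Hh & _ & _ & c); auto.
Qed.

Lemma canonical_not_nil (l : list Q) : canonical Q H l -> l <> [].
Proof. now intros c ->. Qed.

Lemma canonical_change_head (h k : Q) (l : list Q) :
  canonical Q H (h :: l) -> H k -> k^* ≤ h^* -> canonical Q H (k :: l).
Proof.
  destruct l as [| g l]; simpl; [auto|].
  intros (Hh & [hg neq] & nE & c) Hk le; repeat split; auto.
  - now apply ele_trans with h^*.
  - intros eq; apply neq; apply ele_antisym; auto using E_star, E_plus.
    now rewrite <- eq.
Qed.

(** After restricting [h] to [k^+], its star is at most [k^+]. If they are equal, [k] is multiplied
    in; if not, a projection [k] is absorbed by H2, and otherwise the list is already canonical. A
    new head has star at most that of [k], so the junction with [l] survives. *)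
Lemma canonical_cons (h : Q) (l : list Q) : H h -> canonical Q H l ->
  exists l', canonical Q H l' /\ prodQ Q l' = prodQ Q (h :: l) /\
    hword (h :: l) ≈ hword l' /\ lstar l' ≤ lstar l.
Proof.
  intros Hh c.
  destruct l as [| k l]; [contradiction|].
  assert (Hk : H k) by (apply canonical_Forall in c; now inversion c).
  destruct (H_mulE h k^+ Hh (E_plus k)) as [Hhk S].
  assert (Prod : h * k^+ * (k * prodQ Q l) = h * (k * prodQ Q l))
    by now rewrite <- bmulA, (bmulA k^+), plus_mul.
  assert (R := hword_restrict h k l Hk Hh).
  destruct (classic ((h * k^+)^* = k^+)) as [eq | neq].
  - exists (h * k^+ * k :: l).
    destruct (H_mul (h * k^+) k Hhk Hk eq) as (Hw & Sw & _).
    repeat split.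
    + apply canonical_change_head with k; auto.
      rewrite Sw; apply ele_refl, E_star.
    + simpl; rewrite <- Prod; now rewrite !bmulA.
    + eapply pl_trans; [exact R | now apply hword_mul].
    + destruct l as [| g l]; unfold lstar; simpl last; rewrite ?Sw;
        apply ele_refl, E_star.
  - destruct (classic (E k)) as [Ek | nEk].
    + rewrite E_plus_id in * by exact Ek.
      assert (Sk : (h * k)^* ≤ k^*).
      { rewrite S, (E_star_id k) by exact Ek; now apply ele_mul_r. }
      exists (h * k :: l); repeat split.
      * now apply canonical_change_head with k.
      * simpl; now rewrite !bmulA.
      * simpl; rewrite S, pi_mulE, theta_mul, (pi_E k Ek), (E_star_id k)
          by (exact Ek || apply E_star).
        apply pl_eq_cons.
        eapply pl_trans; [apply pl_eq_cons, pl_one_l | apply pl_mulX].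
      * destruct l as [| g l]; unfold lstar; simpl last; [exact Sk|].
        apply ele_refl, E_star.
    + exists (h * k^+ :: k :: l); repeat split; auto.
      * rewrite S; apply ele_mul_r, E_plus.
      * apply ele_refl, E_star.
Qed.

Lemma canonical_exists (l : list Q) : Forall H l -> l <> [] ->
  exists l', canonical Q H l' /\ prodQ Q l' = prodQ Q l /\
    hword l ≈ hword l' /\ lstar l' ≤ lstar l.
Proof.
  induction 1 as [| h l Hh Hl IH]; intros nl; [now elim nl|].
  destruct l as [| k l].
  - exists [h]; repeat split; [exact Hh | apply pl_refl | apply ele_refl, E_star].
  - destruct IH as (l1 & c1 & p1 & w1 & s1); [discriminate|].
    destruct (canonical_cons h l1 Hh c1) as (l2 & c2 & p2 & w2 & s2).
    exists l2; repeat split; auto.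
    + rewrite p2; simpl; now rewrite p1.
    + apply pl_trans with (hword (h :: l1)); [|exact w2].
      now apply (pl_eq_app _ _ _ (hword [h]) (hword [h])); [apply pl_refl|].
    + now apply ele_trans with (lstar l1).
Qed.

Lemma canonical_unique (l l' : list Q) : canonical Q H l -> canonical Q H l' ->
  prodQ Q l = prodQ Q l' -> l = l'.
Proof.
  intros c c' eq.
  destruct (proj2 (proj2 (proj2 HH)) (prodQ Q l)) as (l0 & _ & uniq).
  now rewrite <- (uniq l), <- (uniq l').
Qed.

(** By uniqueness of canonical forms, the word of a factorisation over [H] depends, up to [≈], only
    on the product. *)
Lemma hword_canonical (l l' : list Q) : Forall H l -> l <> [] -> canonical Q H l' ->
  prodQ Q l = prodQ Q l' -> hword l ≈ hword l'.
Proof.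
  intros Hl nl c' eq.
  destruct (canonical_exists l Hl nl) as (l1 & c1 & p1 & w1 & _).
  now rewrite <- (canonical_unique l1 l') by congruence.
Qed.

(* With [e] the star of the product, multiplying the last factor by [e] leaves
   the product unchanged, and reduction to canonical form never enlarges the
   star of the last factor; so uniqueness of canonical forms bounds it by [e]. *)
Lemma star_prodQ (l : list Q) : canonical Q H l -> (prodQ Q l)^* = lstar l.
Proof.
  intros c.
  destruct (exists_last (canonical_not_nil l c)) as (l0 & h & ->).
  unfold lstar; rewrite last_last.
  assert (Hl := canonical_Forall _ c).
  apply Forall_app in Hl; destruct Hl as [Hl0 Hh]; inversion_clear Hh as [| ? ? Hh' _].
  set (q := prodQ Q (l0 ++ [h])).
  assert (Pq : q = prodQ Q l0 * h).
  { unfold q; rewrite prodQ_app; simpl; now rewrite bmul1r. }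
  assert (le : q^* ≤ h^*).
  { assert (qh : q = q * h^*) by now rewrite Pq, <- bmulA, mul_star.
    rewrite qh; unfold ele; apply HQ. }
  apply ele_antisym; auto using E_star.
  destruct (H_mulE h q^* Hh' (E_star q)) as [Hhe S].
  rewrite (E_comm h^*), le in S by apply E_star.
  destruct (canonical_exists (l0 ++ [h * q^*])) as (l1 & c1 & p1 & _ & s1).
  - apply Forall_app; auto.
  - now destruct l0.
  - assert (E1 : l1 = l0 ++ [h]).
    { apply canonical_unique; auto.
      fold q; rewrite p1, prodQ_app; simpl.
      now rewrite bmul1r, bmulA, <- Pq, mul_star. }
    subst l1; revert s1; unfold lstar; rewrite !last_last, S; auto.
Qed.

(** * The normal form of a canonical form *)

(** Each star is paired with the image of the next factor. The last is paired with [1_T], or dropped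
    when it embeds as [1_X], which normal forms exclude. *)
Fixpoint nf_of (l : list Q) : T * list (X * T) :=
  match l with
  | [] => (mone T, [])
  | [h] => (pi h, if excluded_middle_informative (theta h^* = sone X) then []
                  else [(theta h^*, mone T)])
  | h :: rest => (pi h, (theta h^*, fst (nf_of rest)) :: snd (nf_of rest))
  end.

Lemma nf_of_cons2 (h k : Q) (l : list Q) :
  nf_of (h :: k :: l) = (pi h, (theta h^*, pi k) :: snd (nf_of (k :: l))).
Proof. destruct l; reflexivity. Qed.

Lemma fst_nf_of (h : Q) (l : list Q) : fst (nf_of (h :: l)) = pi h.
Proof. destruct l; reflexivity. Qed.

Lemma nf_of_word (l : list Q) : l <> [] ->
  hword l ≈ nf_word T X (fst (nf_of l)) (snd (nf_of l)).
Proof.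
  induction l as [| h [| k l] IH]; intros nl; [now elim nl | |].
  - simpl; destruct (excluded_middle_informative _) as [-> | _]; simpl.
    + eapply pl_trans; [apply pl_eq_cons, pl_sym, pl_one | apply pl_one_r].
    + apply pl_eq_cons, pl_sym, pl_one_r.
  - rewrite nf_of_cons2.
    apply (pl_eq_app _ _ _ (hword [h]) (hword [h])); [apply pl_refl|].
    rewrite fst_nf_of in IH; apply IH; discriminate.
Qed.

Lemma canonical_plus (h : Q) (l : list Q) :
  canonical Q H (h :: l) -> (prodQ Q (h :: l))^+ = h^+.
Proof.
  revert h; induction l as [| k l IH]; intros h c; simpl; [now rewrite bmul1r|].
  destruct c as (Hh & [le _] & nE & c).
  rewrite plus_mul_plus.
  change (k * prodQ Q l) with (prodQ Q (k :: l)); rewrite IH by exact c.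
  now rewrite <- (mul_star h) at 1; rewrite <- bmulA, le, mul_star.
Qed.

Lemma theta_lt (e f : Q) : E e -> E f -> elt Q e f -> slt X (theta e) (theta f).
Proof.
  intros Ee Ef [le neq]; split.
  - unfold sle; rewrite <- theta_mul by assumption; now rewrite le.
  - intros eq; apply neq; now apply theta_inj.
Qed.

Lemma nf_of_ok (l : list Q) : canonical Q H l -> nf_ok T X lact (snd (nf_of l)).
Proof.
  induction l as [| h [| k l] IH]; intros c; [contradiction | |].
  - simpl; destruct (excluded_middle_informative _) as [_ | neq]; simpl; auto.
    change (wplus [inl (mone T)]) with (lact (mone T) (sone X)).
    rewrite (proj1 lact_ol_action).
    repeat split; auto; apply sle_one.
  - destruct c as (Hh & lt & nE & c).
    assert (Hl := canonical_Forall _ c).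
    assert (Hk : H k) by now inversion Hl.
    rewrite nf_of_cons2; cbn [snd]; specialize (IH c).
    (* The congruence preserves [wplus], so the projection of the remaining normal form is
       [theta k^+]; strictness then comes from injectivity of [theta]. *)
    assert (W := wplus_pl_eq _ _ _ lact_ol_action _ _
                   (nf_of_word (k :: l) ltac:(discriminate))).
    rewrite wplus_hword, canonical_plus in W by (assumption || discriminate).
    rewrite fst_nf_of in W; unfold nf_word in W.
    apply theta_lt in lt; [| apply E_star | apply E_plus].
    rewrite W in lt.
    refine (conj (slt_neq_one _ _ _ lt) (conj _ (conj lt IH))).
    intros _ pk; apply nE; now apply H_pi_one.
Qed.

Lemma nf_of_star (l : list Q) : canonical Q H l ->
  (snd (nf_of l) = [] /\ theta (lstar l) = sone X) \/
  (exists ps en tn, snd (nf_of l) = ps ++ [(en, tn)] /\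
     ((tn = mone T /\ theta (lstar l) = en) \/
      (tn <> mone T /\ theta (lstar l) = sone X))).
Proof.
  induction l as [| h [| k l] IH]; intros c; [contradiction | |].
  - unfold lstar; simpl; destruct (excluded_middle_informative _) as [eq | neq]; [auto|].
    right; exists [], (theta h^*), (mone T); auto.
  - destruct c as (Hh & _ & nE & c).
    assert (Hk : H k) by (apply canonical_Forall in c; now inversion c).
    rewrite nf_of_cons2; cbn [snd]; right.
    change (lstar (h :: k :: l)) with (lstar (k :: l)).
    destruct (IH c) as [[-> st] | (ps & en & tn & -> & st)].
    (* The rest yields no pair only if its last star embeds as [1_X]. The final entry is then
       [pi k], nontrivial since [k] is not a projection, and the star is still [1_X]. *)
    + exists [], (theta h^*), (pi k); split; [reflexivity|].
      right; split; [|exact st].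
      intros pk; apply nE; now apply H_pi_one.
    + now exists ((theta h^*, pi k) :: ps), en, tn.
Qed.

Lemma nf_of_inj (l l' : list Q) : canonical Q H l -> canonical Q H l' ->
  nf_of l = nf_of l' -> l = l'.
Proof.
  (* A single factor yields at most one pair, ending in [1_T]; a longer list has [pi g] there, which
     would force [g] into [E]. *)
  assert (short_long : forall h k g r, canonical Q H (k :: g :: r) ->
            nf_of [h] <> nf_of (k :: g :: r)).
  { intros h k g r (_ & _ & nE & c) eq; rewrite nf_of_cons2 in eq.
    assert (Hg : H g) by (apply canonical_Forall in c; now inversion c).
    apply nE, (H_pi_one g Hg).
    simpl in eq; destruct (excluded_middle_informative _); congruence. }
  revert l'; induction l as [| h [| g l] IH]; intros l' c c' eq; [contradiction | |].
  - destruct l' as [| k [| g' l']]; [contradiction | | now apply short_long in eq].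
    f_equal; simpl in eq; injection eq as pe se; apply H_inj; auto.
    apply theta_inj; auto using E_star.
    destruct (excluded_middle_informative _), (excluded_middle_informative _);
      congruence.
  - destruct l' as [| k [| g' l']]; [contradiction | |].
    { symmetry in eq; now apply short_long in eq. }
    rewrite !nf_of_cons2 in eq.
    assert (ph : pi h = pi k) by congruence.
    assert (sh : theta h^* = theta k^*) by congruence.
    assert (pg : pi g = pi g') by congruence.
    assert (ps : snd (nf_of (g :: l)) = snd (nf_of (g' :: l'))) by congruence.
    destruct c as (Hh & _ & _ & c), c' as (Hk & _ & _ & c').
    f_equal.
    + apply H_inj; auto; apply theta_inj; auto using E_star.
    + apply IH; auto.
      rewrite (surjective_pairing (nf_of (g :: l))), (surjective_pairing (nf_of (g' :: l'))).
      now rewrite !fst_nf_of, pg, ps.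
Qed.

Lemma hword_inj (l l' : list Q) : canonical Q H l -> canonical Q H l' ->
  hword l ≈ hword l' -> l = l'.
Proof.
  intros c c' eq; apply nf_of_inj; auto.
  destruct (nf_word_unique T X lact lact_ol_action (fst (nf_of l)) (fst (nf_of l'))
              (snd (nf_of l)) (snd (nf_of l'))) as [e1 e2]; auto using nf_of_ok.
  - eapply pl_trans; [apply pl_sym, nf_of_word; now apply canonical_not_nil|].
    eapply pl_trans; [exact eq | apply nf_of_word; now apply canonical_not_nil].
  - now apply injective_projections.
Qed.

Lemma hword_star (l : list Q) : canonical Q H l ->
  pl_star T X lact (hword l) (theta (prodQ Q l)^*).
Proof.
  intros c; rewrite star_prodQ by exact c.
  exists (fst (nf_of l)), (snd (nf_of l)); split; [|split].
  - apply nf_of_word; now apply canonical_not_nil.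
  - now apply nf_of_ok.
  - now apply nf_of_star.
Qed.

(** * The isomorphism onto [Q_l] *)

Lemma hword_inQl (l : list Q) : Forall H l -> l <> [] -> inQl T X lact imE (hword l).
Proof.
  assert (one : forall h, H h -> inQl T X lact imE (hword [h])).
  { intros h Hh; apply Ql_gen.
    - exists h^*; split; [apply E_star | reflexivity].
    - exists h^+; split; [apply E_plus | now rewrite lact_theta]. }
  induction 1 as [| h [| k l] Hh Hl IH]; intros nl; [now elim nl | now apply one |].
  apply (Ql_mul T X lact imE (hword [h])); [now apply one | now apply IH].
Qed.

Lemma inQl_hword (w : list (letter T X)) : inQl T X lact imE w ->
  exists l, Forall H l /\ l <> [] /\ w ≈ hword l.
Proof.
  induction 1 as [t x (e & Ee & <-) (f & Ef & eq)
                 | u v _ (l & Hl & nl & ul) _ (l' & Hl' & nl' & vl')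
                 | u v _ (l & Hl & nl & ul) uv].
  - destruct (lact_theta_defined t e f Ee (eq_sym eq)) as (h & Hh & <- & <-).
    exists [h]; repeat split; [auto | discriminate | apply pl_refl].
  - exists (l ++ l'); repeat split.
    + now apply Forall_app.
    + now destruct l.
    + rewrite hword_app; now apply pl_eq_app.
  - exists l; repeat split; auto.
    now apply pl_trans with u; [apply pl_sym|].
Qed.

Lemma Ql_representation :
  Ql_biunary_monoid T X lact imE /\
  exists phi : Q -> list (letter T X),
    (forall q, inQl T X lact imE (phi q)) /\
    (forall p q, phi p ≈ phi q -> p = q) /\
    (forall w, inQl T X lact imE w -> exists q, w ≈ phi q) /\
    (forall p q, phi (p * q) ≈ phi p ++ phi q) /\
    (forall q, phi q^+ ≈ [inr (wplus (phi q))]) /\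
    (forall q, exists e, pl_star T X lact (phi q) e /\ phi q^* ≈ [inr e]).
Proof.
  destruct (functional_choice (fun q l => canonical Q H l /\ prodQ Q l = q))
    as [cf Hcf].
  { intros q; destruct (proj2 (proj2 (proj2 HH)) q) as (l & Hl & _); now exists l. }
  set (phi q := hword (cf q)).
  assert (c : forall q, canonical Q H (cf q)) by (intros q; apply Hcf).
  assert (pr : forall q, prodQ Q (cf q) = q) by (intros q; apply Hcf).
  assert (Hc : forall q, Forall H (cf q)) by auto using canonical_Forall.
  assert (nc : forall q, cf q <> []) by auto using canonical_not_nil.
  (* [phi] may be computed from any factorisation over [H], so multiplicativity reduces to
     concatenating lists. *)
  assert (eq_phi : forall l, Forall H l -> l <> [] -> hword l ≈ phi (prodQ Q l))
    by (intros; apply hword_canonical; auto).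
  assert (phi_Ql : forall q, inQl T X lact imE (phi q))
    by (intros; now apply hword_inQl).
  assert (phi_surj : forall w, inQl T X lact imE w -> exists q, w ≈ phi q).
  { intros w Hw; destruct (inQl_hword w Hw) as (l & Hl & nl & wl).
    exists (prodQ Q l); apply pl_trans with (hword l); auto. }
  assert (phi_mul : forall p q, phi (p * q) ≈ phi p ++ phi q).
  { intros p q; apply pl_sym; unfold phi at 1 2; rewrite <- hword_app.
    rewrite <- (pr p) at 2; rewrite <- (pr q) at 2; rewrite <- prodQ_app.
    apply eq_phi; [now apply Forall_app|].
    intros eq; now apply app_eq_nil in eq as [? _]; apply (nc p). }
  assert (phi_E : forall e, E e -> phi e ≈ [inr (theta e)]).
  { intros e Ee; apply pl_trans with (hword [e]); [|now apply hword_E].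
    apply pl_sym; rewrite <- (bmul1r e) at 2; apply (eq_phi [e]); [|discriminate].
    auto using H_E. }
  assert (phi_plus : forall q, wplus (phi q) = theta q^+).
  { intros q; unfold phi; now rewrite wplus_hword, pr. }
  assert (phi_star : forall q, pl_star T X lact (phi q) (theta q^* )).
  { intros q; rewrite <- (pr q) at 2; now apply hword_star. }
  assert (Act := lact_ol_action).
  split; [split; [|split]|exists phi; repeat split; auto].
  - intros w Hw; destruct (phi_surj w Hw) as [q wq].
    apply Ql_eq with (phi q^+); [apply phi_Ql|].
    rewrite (wplus_pl_eq _ _ _ Act _ _ wq), phi_plus; apply phi_E, E_plus.
  - intros w x Hw st; destruct (phi_surj w Hw) as [q wq].
    rewrite (pl_star_unique _ _ _ Act (phi q) x (theta q^* )); auto.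
    + apply Ql_eq with (phi q^* ); [apply phi_Ql | apply phi_E, E_star].
    + now apply (pl_star_pl_eq _ _ _ w).
  (* The identity is represented by [theta 1], which may differ from the identity [1_X] of [P_l]. *)
  - exists (phi 1); split; [apply phi_Ql|].
    intros w Hw; destruct (phi_surj w Hw) as [q wq]; split.
    + apply pl_trans with (phi 1 ++ phi q).
      { apply pl_eq_app; [apply pl_refl | exact wq]. }
      apply pl_trans with (phi q); [|now apply pl_sym].
      rewrite <- (bmul1l q) at 2; apply pl_sym, phi_mul.
    + apply pl_trans with (phi q ++ phi 1).
      { apply pl_eq_app; [exact wq | apply pl_refl]. }
      apply pl_trans with (phi q); [|now apply pl_sym].
      rewrite <- (bmul1r q) at 2; apply pl_sym, phi_mul.
  - intros p q eq; rewrite <- (pr p), <- (pr q); f_equal; now apply hword_inj.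
  - intros q; rewrite phi_plus; apply phi_E, E_plus.
  - intros q; exists (theta q^* ); split; [apply phi_star | apply phi_E, E_star].
Qed.

End Globalisation.

Theorem mainTheorem20 :
  forall (Q : BiMonoid) (H : Q -> Prop),
    star_left_ehresmann Q -> proper_basis Q H ->
  forall (T : Monoid) (pi : Q -> T),
    (* T = Q/sigma, realized as a surjective monoid morphism with kernel sigma *)
    (forall a b, pi (bmul Q a b) = mmul T (pi a) (pi b)) -> pi (bone Q) = mone T ->
    (forall t : T, exists q, pi q = t) ->
    (forall a b, pi a = pi b <-> sigma Q a b) ->
  exists (X : Semilattice1) (act : T -> X -> X) (Y : X -> Prop) (eY : X),
    ol_action T X act /\ subsemilattice1 X Y eY /\ condA T X act Y /\ condB T X act Y /\
    (* Y is isomorphic to E *)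
    (exists psi : Q -> X,
       (forall e, projE Q e -> Y (psi e)) /\
       (forall e f, projE Q e -> projE Q f -> psi e = psi f -> e = f) /\
       (forall y, Y y -> exists e, projE Q e /\ psi e = y) /\
       (forall e f, projE Q e -> projE Q f -> psi (bmul Q e f) = smul X (psi e) (psi f))) /\
    (* Q_l(T,X,Y) is a biunary monoid subsemigroup of P_l(T,X) *)
    Ql_biunary_monoid T X act Y /\
    (* Q is isomorphic to Q_l(T,X,Y) as a biunary monoid *)
    (exists phi : Q -> list (letter T X),
       (forall q, inQl T X act Y (phi q)) /\
       (forall p q, pl_eq T X act (phi p) (phi q) -> p = q) /\
       (forall w, inQl T X act Y w -> exists q, pl_eq T X act w (phi q)) /\
       (forall p q, pl_eq T X act (phi (bmul Q p q)) (phi p ++ phi q)) /\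
       (forall q, pl_eq T X act (phi (bplus Q q)) [inr (wplus T X act (phi q))]) /\
       (forall q, exists e, pl_star T X act (phi q) e /\ pl_eq T X act (phi (bstar Q q)) [inr e])).
Proof.
  intros Q H HQ HH T pi pi_mul pi_one pi_surj pi_ker.
  exists (lset_semilattice Q H T pi), (lact Q H T pi).
  set (th := theta Q H HQ HH T pi pi_mul pi_one pi_surj pi_ker).
  exists (imE Q H HQ HH T pi pi_mul pi_one pi_surj pi_ker), (th (bone Q)).
  split; [apply lact_ol_action|].
  split; [apply imE_subsemilattice|].
  split; [apply imE_condA|].
  split; [apply imE_condB|].
  split; [|apply Ql_representation].
  exists th; repeat split.
  - intros e Ee; now exists e.
  - intros e f; now apply theta_inj.
  - intros y (e & Ee & <-); now exists e.
  - intros e f; now apply theta_mul.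
Qed.
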